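(* There exists a group $G$ and a $G$-set $U$ such that $U$ is a $G$-retract of the vertex set of some $G$-tree but $U$ is not the vertex set of any $G$-tree.
   Context: All $G$-actions are left actions; $G_x$ denotes the stabilizer of $x$. A $G$-graph consists of a nonempty $G$-set $V$ (vertices), a $G$-set $E$ (edges) and $G$-maps $\iota,\tau\colon E\to V$ (initial and terminal vertex maps); so edges are oriented and $G$ preserves the orientation. A $G$-tree is a $G$-graph whose underlying graph (forgetting orientation) is a tree. A $G$-retract $U$ of a $G$-set $V$ is a $G$-subset of $V$ such that, for each $w\in V-U$, there exists $u\in U$ with $G_w\le G_u$; equivalently, there exists a $G$-map $V\to U$ which is the identity on $U$. ''$U$ is the vertex set of a $G$-tree'' refers to $U$ as a $G$-set (i.e. with its given $G$-action). *)

(* Defs.v *)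
From Stdlib Require List.
From mathcomp Require Import all_boot.
From mathcomp Require Import monoid.
Set Implicit Arguments.
Unset Strict Implicit.
Unset Printing Implicit Defensive.
Local Open Scope group_scope.

Record gset (G : groupType) := GSet {
  gset_sort :> Type;
  gact : G -> gset_sort -> gset_sort;
  gact1 : forall x, gact 1 x = x;
  gactM : forall g h x, gact (g * h) x = gact g (gact h x)
}.

Definition stab (G : groupType) (X : gset G) (x : X) : G -> Prop :=
  fun g => gact g x = x.

Definition gmap (G : groupType) (X Y : gset G) (f : X -> Y) : Prop :=
  forall g x, f (gact g x) = gact g (f x).

Definition gretract (G : groupType) (V : gset G) (U : V -> Prop) : Prop :=
  (forall g x, U x -> U (gact g x)) /\
  (forall w, ~ U w -> exists u, U u /\ (forall g, stab w g -> stab u g)).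

Record ggraph (G : groupType) := GGraph {
  vert : gset G;
  edge : gset G;
  iota_ : edge -> vert;
  tau_ : edge -> vert;
  vert_nonempty : inhabited vert;
  iota_gmap : gmap iota_;
  tau_gmap : gmap tau_
}.

Section Underlying.
Variables (V E : Type) (iota tau : E -> V).

(* [(e, true)] is [e] traversed from [iota e] to [tau e], and [(e, false)] is
   [e] traversed backwards. *)
Definition dsource (d : E * bool) : V := if d.2 then iota d.1 else tau d.1.
Definition dtarget (d : E * bool) : V := if d.2 then tau d.1 else iota d.1.

Fixpoint walk (x : V) (p : seq (E * bool)) (y : V) : Prop :=
  match p with
  | [::] => x = y
  | d :: p' => dsource d = x /\ walk (dtarget d) p' y
  end.

Definition connected_graph : Prop := forall x y, exists p, walk x p y.

(* Distinctness of the edges only matters for length 2, where it excludes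
   going back and forth along one edge; loops and pairs of parallel edges are
   circuits. *)
Definition circuit (x : V) (p : seq (E * bool)) : Prop :=
  [/\ p <> [::], walk x p x,
      List.NoDup [seq dsource d | d <- p] & List.NoDup [seq d.1 | d <- p]].

Definition is_tree : Prop :=
  [/\ inhabited V, connected_graph & forall x p, ~ circuit x p].
End Underlying.

Definition gtree (G : groupType) (T : ggraph G) : Prop :=
  is_tree (@iota_ G T) (@tau_ G T).

(* Membership of an abstract [G]-set among subsets or vertex sets is up to
   isomorphism of [G]-sets: [U] is identified with its image under an
   injective [G]-map. *)
Definition retract_of_vertices (G : groupType) (U : gset G) : Prop :=
  exists T : ggraph G, gtree T /\
    exists f : U -> vert T,
      [/\ gmap f, injective f & gretract (fun v => exists u, f u = v)].

Definition is_vertex_set (G : groupType) (U : gset G) : Prop :=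
  exists T : ggraph G, gtree T /\
    exists f : U -> vert T, gmap f /\ bijective f.

(* Main.v *)
Require Import Defs.
From mathcomp Require Import all_boot.
From mathcomp Require Import monoid.
From HB Require Import structures.
From mathcomp Require Import order ssralg ssrnum ssrint zify boolp.
From Stdlib Require List.

(** The group G is a lamplighter group: a semidirect product L : Z, where L
    consists of the sets of integers that are bounded below (the lit lamps),
    under symmetric difference, and the generator of Z translates lamps by 1.
    Let A be the set of elements of L supported on [0, oo), and C < A those
    supported on {0} together with [2, oo).  The
    cosets have an explicit description: an element of G/A (of G/C) at level n is a
    configuration seen only at the positions i < n (resp. at i < n and at
    i = n + 1); its stabilizer consists of the lamps elsewhere.

    U = G/C is a retract of the vertex set of a G-tree.  The set G/A is the
    vertex set of the tree of an ascending HNN extension: the parent of a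
    vertex forgets one more position and lowers the level by 1, and any two
    vertices have a common ancestor because configurations are bounded below.
    Hang on it, as leaves, the elements of U, each attached to the element of
    G/A at the same level n that forgets the position n + 1 ([parent_tree]
    shows that the result is a tree).  The stabilizer of a vertex of G/A at
    level n also fixes the restriction of that vertex to an element of U at
    level n - 2: the extra position seen there, n - 1, is still below n
    ([U_retract]).

    Suppose that a G-tree has vertex set U ([no_tree_with_levels]).  In a tree
    the reduced walk between two vertices is unique ([reduced_walk_unique]),
    so whatever fixes its ends fixes all of it.  The lamp at i fixes a vertex of level n
    iff i = n or i >= n + 2.  Three consequences follow.
    - An edge never joins two vertices of the same level: L has exponent 2, so
      some element would exchange the two ends, and G has no inversions.
    - The vertices of level at most m are the common fixed points of the lamps
      at positions >= m + 2, hence they span a subtree; so each vertex has at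
      most one edge to a lower level.  As G is transitive on vertices, all
      edges drop by the same number k of levels.
    - The vertices fixed by the lamps at 0 and at all i >= 2 are those of
      level 0 or at most -2.  The reduced walk from a vertex of level 0 to one
      of level -2 stays among them, and its first edge must therefore drop by
      at least 2, that is, k >= 2.
    Levels 0 and 1 are then not connected, as k does not divide 1. *)

Set Implicit Arguments.
Unset Strict Implicit.
Unset Printing Implicit Defensive.
Import Order.TTheory GRing.Theory Num.Theory.

(** * Reduced walks in graphs without circuits *)

Section ReducedWalks.
Variables (V E : Type) (iota tau : E -> V).
Notation walk := (walk iota tau).
Notation source := (dsource iota tau).
Notation target := (dtarget iota tau).

Definition dinv (d : E * bool) : E * bool := (d.1, ~~ d.2).

Definition reduced (p : seq (E * bool)) : Prop :=
  forall p1 d p2, p <> p1 ++ d :: dinv d :: p2.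

Definition walk_rev (p : seq (E * bool)) := rev (map dinv p).

Lemma dinvK : involutive dinv.
Proof. by case=> e b; rewrite /dinv /= negbK. Qed.

Lemma source_dinv d : source (dinv d) = target d.
Proof. by case: d => e []. Qed.

Lemma target_dinv d : target (dinv d) = source d.
Proof. by case: d => e []. Qed.

Lemma walk_cat x p q y :
  walk x (p ++ q) y <-> exists2 z, walk x p z & walk z q y.
Proof.
elim: p x => [|d p IHp] x /=.
  by split=> [xqy | [z -> //]]; exists x.
split=> [[dx /IHp[z pz qz]] | [z [dx pz] qz]]; first by exists z.
by split=> //; apply/IHp; exists z.
Qed.

Lemma walk_rev_walk x p y : walk x p y -> walk y (walk_rev p) x.
Proof.
elim: p x => [|d p IHp] x //= [dx /IHp py].
rewrite /walk_rev /= rev_cons -cats1; apply/walk_cat; exists (target d) => //=.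
by rewrite source_dinv target_dinv.
Qed.

Lemma reduced_catl p q : reduced (p ++ q) -> reduced p.
Proof. by move=> rpq p1 d p2 Ep; apply: (rpq p1 d (p2 ++ q)); rewrite Ep -catA. Qed.

Lemma reduced_catr p q : reduced (p ++ q) -> reduced q.
Proof. by move=> rpq p1 d p2 Eq; apply: (rpq (p ++ p1) d p2); rewrite Eq catA. Qed.

Lemma reduced_cons d p :
  reduced p -> (forall q, p <> dinv d :: q) -> reduced (d :: p).
Proof.
move=> rp dp [|c p1] b p2 /= []; first by move=> <-; apply: dp.
by move=> _; apply: rp.
Qed.

Lemma reduced_rev p : reduced p -> reduced (walk_rev p).
Proof.
move=> rp p1 d p2 /(congr1 walk_rev).
rewrite /walk_rev map_rev revK -map_comp (eq_map (g := id)); last exact: dinvK.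
rewrite map_id map_cat rev_cat /= !rev_cons dinvK -!cats1 -!catA /=.
exact: rp.
Qed.

(** Written with [rcons] so that the only new adjacent pair, the last edge of
    the first walk and the head of the second, can be named. *)
Lemma reduced_glue p d q :
    reduced (rcons p d) -> reduced q -> (forall q', q <> dinv d :: q') ->
  reduced (rcons p d ++ q).
Proof.
elim: p => [|c p IHp] /= rpd rq dq; first exact: reduced_cons.
apply: reduced_cons => [|q' Eq].
  by apply: IHp => //; move: rpd; rewrite -cat1s; apply: reduced_catr.
case: p Eq rpd {IHp} => [|a p] /= [Ea _] rpd.
  by apply: (rpd [::] c [::]); rewrite Ea.
by apply: (rpd [::] c (rcons p d)); rewrite Ea.
Qed.

(** Deleting one backtracking pair keeps the ends and shortens the walk. *)
Lemma walk_reduce x p y : walk x p y -> exists2 q, walk x q y & reduced q.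
Proof.
have [n] := ubnP (size p); elim: n p => // n IHn p; rewrite ltnS => lepn xpy.
case: (EM (reduced p)) => [rp | /existsNP[p1 /existsNP[d /existsNP[p2]]]].
  by exists p.
move=> /contrapT Ep; apply: (IHn (p1 ++ p2)).
  by apply: leq_trans lepn; rewrite Ep !size_cat /=; lia.
move: xpy; rewrite Ep => /walk_cat[z xz /= [dz [_]]].
by rewrite target_dinv dz => zy; apply/walk_cat; exists z.
Qed.

Lemma not_NoDup_map (A B : Type) (f : A -> B) (s : seq A) :
    ~ List.NoDup (map f s) ->
  exists s1 a s2 b s3, s = s1 ++ a :: s2 ++ b :: s3 /\ f a = f b.
Proof.
elim: s => [|a s IHs] /=; first by case; constructor.
case: (EM (List.In (f a) (map f s))) => [/List.in_map_iff[b [fb bs]] | fa] ds.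
  by have [s2 [s3 ->]] := List.in_split _ _ bs; exists [::], a, s2, b, s3.
case: IHs => [us|]; first by case: ds; constructor.
by move=> s1 [b [s2 [c [s3 [-> fbc]]]]]; exists (a :: s1), b, s2, c, s3.
Qed.

Lemma NoDup_map_cat (A B : Type) (f : A -> B) s1 a s2 b s3 :
  List.NoDup (map f (s1 ++ a :: s2 ++ b :: s3)) -> f a <> f b.
Proof.
elim: s1 => [|c s1 IHs] /= /List.NoDup_cons_iff[nca ds]; last exact: IHs.
move=> fab; apply: nca; rewrite map_cat; apply/List.in_or_app; right.
by left.
Qed.

Hypothesis no_circuit : forall x p, ~ circuit iota tau x p.

(** A shortest counterexample is a circuit.  Two equal sources would cut out a
    shorter closed walk.  If the sources are distinct, an edge can only be
    repeated in opposite directions; then the edge following the first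
    passage starts where the second passage starts, so it is the second
    passage, and the walk backtracks. *)
Lemma closed_reduced_nil x p : walk x p x -> reduced p -> p = [::].
Proof.
have [n] := ubnP (size p); elim: n x p => // n IHn x p; rewrite ltnS => lepn.
move=> xpx rp; apply: contrapT => p0.
have uniq_sources : List.NoDup (map source p).
  apply: contrapT => nd; have [p1 [a [p2 [b [p3 [Ep sab]]]]]] := not_NoDup_map nd.
  suff: a :: p2 = [::] by [].
  apply: (IHn (source a)).
  - by move: lepn; rewrite Ep !size_cat /= size_cat /=; lia.
  - move: xpx; rewrite Ep => /walk_cat[z _ /=[_ /walk_cat[t p2t /=[bt _]]]].
    by split=> //; rewrite sab bt.
  - by move: rp; rewrite Ep -cat_cons => /reduced_catr/reduced_catl.
apply: (@no_circuit x p); split=> //.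
apply: contrapT => nd; have [p1 [a [p2 [b [p3 [Ep ab]]]]]] := not_NoDup_map nd.
move: uniq_sources; rewrite Ep => us.
have [sab|nsab] := eqVneq a.2 b.2.
  by apply: (NoDup_map_cat us); move: ab sab; case: (a) (b) => [? ?] [? ?] /= -> ->.
have Eb : b = dinv a.
  move: ab nsab; case: (a) (b) => [e1 b1] [e2 b2] /= ->.
  by rewrite /dinv /=; case: b1 b2 => [] [].
case: p2 Ep us => [|c p2] Ep us.
  by apply: (rp p1 a p3); rewrite Ep Eb.
move: xpx; rewrite Ep => /walk_cat[z _ /=[_ [ca _]]].
apply: (@NoDup_map_cat _ _ source (p1 ++ [:: a]) c p2 b p3).
  by rewrite -catA.
by rewrite ca Eb source_dinv.
Qed.

(** After their common prefix, one walk reversed followed by the other is a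
    closed reduced walk. *)
Lemma reduced_walk_unique x y p q :
  walk x p y -> walk x q y -> reduced p -> reduced q -> p = q.
Proof.
elim: p x q => [|d p IHp] x q.
  by move=> /= <- xqx _ rq; rewrite (closed_reduced_nil xqx rq).
case: q => [|c q] xpy xqy rp rq.
  suff: d :: p = [::] by [].
  by apply: (@closed_reduced_nil y) rp; move: xpy; rewrite (xqy : x = y).
have [cd|cd] := EM (c = d).
  rewrite cd in xqy rq *; case: xpy xqy => _ py [_ qy]; congr (_ :: _).
  by apply: IHp py qy _ _; [apply: (@reduced_catr [:: d]) rp | apply: (@reduced_catr [:: d]) rq].
suff: walk_rev (c :: q) ++ d :: p = [::] by case: (walk_rev _).
apply: (@closed_reduced_nil y).
  by apply/walk_cat; exists x => //; apply: walk_rev_walk.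
rewrite /walk_rev /= rev_cons; apply: reduced_glue => //.
  by rewrite -rev_cons; apply: (reduced_rev rq).
by move=> q' [dc _]; apply: cd; rewrite dc dinvK.
Qed.

End ReducedWalks.

(** * Group actions on trees *)

Section GraphAction.
Variables (G : groupType) (T : ggraph G).
Notation walk := (walk (@iota_ G T) (@tau_ G T)).
Notation source := (dsource (@iota_ G T) (@tau_ G T)).
Notation target := (dtarget (@iota_ G T) (@tau_ G T)).

Definition dact (g : G) (d : edge T * bool) : edge T * bool := (gact g d.1, d.2).

Lemma source_dact g d : source (dact g d) = gact g (source d).
Proof. by case: d => e []; rewrite /dsource /= ?iota_gmap ?tau_gmap. Qed.

Lemma target_dact g d : target (dact g d) = gact g (target d).
Proof. by case: d => e []; rewrite /dtarget /= ?iota_gmap ?tau_gmap. Qed.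

Lemma dactK g : cancel (dact g) (dact g^-1%g).
Proof. by case=> e b; rewrite /dact /= -gactM mulVg gact1. Qed.

Lemma walk_dact g x p y : walk x p y -> walk (gact g x) (map (dact g) p) (gact g y).
Proof.
elim: p x => [|d p IHp] x /=; first by move=> ->.
by move=> [<- /IHp]; rewrite source_dact target_dact.
Qed.

Lemma reduced_dact g p : reduced p -> reduced (map (dact g) p).
Proof.
move=> rp p1 d p2 /(congr1 (map (dact g^-1%g))).
rewrite mapK; last exact: dactK.
by rewrite map_cat /=; apply: rp.
Qed.

Hypothesis treeT : gtree T.

(** The translate by [g] is again the reduced walk between the same ends.  In
    particular the fixed points of [g] span a subtree. *)
Lemma reduced_walk_fixed g x p y :
    stab x g -> stab y g -> walk x p y -> reduced p ->
  forall d, List.In d p -> dact g d = d.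
Proof.
case: treeT => _ _ nocirc gx gy xpy rp.
have: map (dact g) p = p.
  apply: (reduced_walk_unique nocirc) (reduced_dact rp) rp => //; last exact: xpy.
  by have := walk_dact g xpy; rewrite gx gy.
elim: p {x y gx gy xpy rp} => //= c p IHp [cE pE] d [<- // | ]; last exact: IHp.
Qed.

Lemma tree_reduced_walk x y : exists2 p, walk x p y & reduced p.
Proof. by case: treeT => _ conn _; have [p xpy] := conn x y; apply: walk_reduce xpy. Qed.

End GraphAction.

(** * Trees whose vertices carry levels and lamps *)

Section Obstruction.
Variables (G : groupType) (T : ggraph G).
Variables (level : vert T -> int) (shift : G -> int) (lamp : int -> G).
Notation walk := (walk (@iota_ G T) (@tau_ G T)).
Notation source := (dsource (@iota_ G T) (@tau_ G T)).
Notation target := (dtarget (@iota_ G T) (@tau_ G T)).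
Local Open Scope ring_scope.

Hypothesis treeT : gtree T.
Hypothesis level_act : forall g x, level (gact g x) = level x + shift g.
Hypothesis lamp_stab : forall i x,
  stab x (lamp i) <-> ~~ ((i < level x) || (i == level x + 1)).
(* For vertices of equal level this is where lamps having order 2 enters. *)
Hypothesis transitive_swap : forall x y,
  exists2 g, gact g x = y & level x = level y -> gact g y = x.

Lemma fixed_level g x p y d :
    stab x g -> stab y g -> walk x p y -> reduced p -> List.In d p ->
  stab (source d) g /\ stab (target d) g.
Proof.
move=> gx gy xpy rp dp; have gd := reduced_walk_fixed treeT gx gy xpy rp dp.
by rewrite /stab -source_dact -target_dact gd.
Qed.

(** The vertices of level at most [m] are the common fixed points of the lamps
    at positions at least [m + 2]. *)
Lemma walk_below (m : int) x p y d :
    level x <= m -> level y <= m -> walk x p y -> reduced p -> List.In d p ->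
  level (source d) <= m /\ level (target d) <= m.
Proof.
move=> xm ym xpy rp dp.
have below z : (forall i, m + 2 <= i -> stab z (lamp i)) -> level z <= m.
  move=> zfix; case: (leP (level z) m) => // mz.
  (* The lamp just above the level of [z] moves [z]. *)
  by have/lamp_stab := zfix (level z + 1) ltac:(lia); lia.
by split; apply: below => i mi;
  have [] // := @fixed_level (lamp i) _ _ _ _ _ _ xpy rp dp; apply/lamp_stab; lia.
Qed.

(** An element exchanging the two ends of an edge would carry it to a second
    edge from the target to the source, since orientations are preserved;
    the walks along the edge and back along its translate contradict
    uniqueness. *)
Lemma edge_changes_level d : level (source d) <> level (target d).
Proof.
move=> eq_level; have [g gs /(_ eq_level) gt] := transitive_swap (source d) (target d).
case: treeT => _ _ nocirc.
have red1 c : reduced [:: c] by case=> [|? []].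
have /(congr1 (fun p => head d p)) : [:: d] = [:: dinv (dact g d)].
  apply: (reduced_walk_unique nocirc (x := source d) (y := target d)) => //=.
  by rewrite source_dinv target_dinv source_dact target_dact.
by case: d {eq_level gs gt} => e [].
Qed.

Definition descends d := level (target d) < level (source d).

Lemma descends_or_inv d : descends d \/ descends (dinv d).
Proof.
rewrite /descends source_dinv target_dinv.
by have := @edge_changes_level d; lia.
Qed.

(** Two descending edges at a vertex are joined at their lower ends by a walk
    that stays strictly lower, hence cannot pass through the vertex. *)
Lemma descent_unique d c :
  source d = source c -> descends d -> descends c -> d = c.
Proof.
move=> sdc dd dc; case: (treeT) => _ _ nocirc.
have [q xqy rq] := tree_reduced_walk treeT (target d) (target c).
have below a : List.In a q -> level (target a) < level (source d).
  have tc : level (target c) <= level (source d) - 1.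
    by rewrite sdc; move: dc; rewrite /descends; lia.
  have td : level (target d) <= level (source d) - 1.
    by move: dd; rewrite /descends; lia.
  by move=> aq; have := walk_below td tc xqy rq aq; lia.
have: d :: q = [:: c].
  apply: (reduced_walk_unique nocirc (x := source d) (y := target c)) => //=.
    apply: reduced_cons => // q' Eq.
    have := below (dinv d); rewrite Eq target_dinv /=.
    by move=> /(_ (or_introl erefl)); rewrite ltxx.
  by case=> [|? []].
by case.
Qed.

Lemma descent_constant d c : descends d -> descends c ->
  level (source d) - level (target d) = level (source c) - level (target c).
Proof.
move=> dd dc; have [g gs _] := transitive_swap (source d) (source c).
suff <- : dact g d = c by rewrite source_dact target_dact !level_act; lia.
apply: descent_unique => //; first by rewrite source_dact.
by move: dd; rewrite /descends source_dact target_dact !level_act; lia.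
Qed.

Lemma level_along_walk (k : int) :
    (forall d, descends d -> level (source d) - level (target d) = k) ->
  forall x p y, walk x p y -> exists c : int, level y = level x + c * k.
Proof.
move=> dk x p y; elim: p x => [|d p IHp] x /=.
  by move=> ->; exists 0; lia.
move=> [<- /IHp[c ->]]; case: (descends_or_inv d) => /dk.
  by exists (c - 1); lia.
by rewrite source_dinv target_dinv; exists (c + 1); lia.
Qed.

(** The first edge of the walk from [x0] to [xm2] drops by at least 2, so the
    constant drop cannot divide the difference 1 between the levels of [x0]
    and [x1]. *)
Lemma no_tree_with_levels x0 x1 xm2 :
  level x0 = 0 -> level x1 = 1 -> level xm2 = - 2%:Z -> False.
Proof.
move=> l0 l1 lm2.
have [[|d p] xpy rp] := tree_reduced_walk treeT x0 xm2.
  by move: l0 lm2; rewrite (xpy : x0 = xm2) => ->.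
have sd : source d = x0 by case: xpy.
have tfix (i : int) : i = 0 \/ 2 <= i -> stab (target d) (lamp i).
  move=> i02.
  have [] // : stab (source d) (lamp i) /\ stab (target d) (lamp i).
    apply: (fixed_level _ _ xpy rp (or_introl erefl)); apply/lamp_stab; lia.
have t0 : level (target d) <> 0.
  by have := @edge_changes_level d; rewrite sd l0 => n0 t0; apply: n0.
have tm2 : level (target d) <= - 2%:Z.
  have /lamp_stab := tfix 0 (or_introl erefl).
  (* Level -1 is excluded by the lamp at 0, and a level j >= 1 by the lamp at
     j + 1 >= 2. *)
  have [t1|] : 1 <= level (target d) \/ level (target d) <= -1 by lia.
    by have /lamp_stab := tfix (level (target d) + 1) ltac:(lia); lia.
  by lia.
have dd : descends d by rewrite /descends sd l0; lia.
have [q xq _] := tree_reduced_walk treeT x0 x1.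
have [c] := level_along_walk (fun c => (@descent_constant c d)^~ dd) xq.
rewrite l0 l1 sd l0; move: (level (target d)) tm2 => t tm2 {tfix t0 dd xq}.
have [c0|c0] : c <= 0 \/ 1 <= c by lia.

  by nia.
by nia.
Qed.

End Obstruction.

(** * The tree of a parent function *)

Section ParentTree.
(* Every vertex [v] is also the name of the edge from [v] to [par v]. *)
Variables (V : Type) (par : V -> V) (height : V -> int).
Notation walk := (walk (E := V) id par).
Local Open Scope ring_scope.
Implicit Types (x y : V) (p : seq (V * bool)).

Hypothesis height_par : forall v, height (par v) = height v - 1.
Hypothesis par_meet : forall x y, exists k l, iter k par x = iter l par y.

Lemma walk_iter_par k x : exists p, walk x p (iter k par x).
Proof.
elim: k x => [|k IHk] x; first by exists [::].
by have [p xp] := IHk (par x); exists ((x, true) :: p); rewrite iterSr.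
Qed.

Lemma NoDup_opposite x p :
  List.NoDup (map fst p) -> List.In (x, true) p -> ~ List.In (x, false) p.
Proof.
elim: p => //= -[e b] p IHp /List.NoDup_cons_iff[/= ep np].
have inp c : List.In (x, c) p -> List.In x (map fst p) by apply: (List.in_map fst).
case=> [[ex eb] | xp]; case=> [[ex' eb'] | xp'].
- by rewrite eb' in eb.
- by apply: ep; rewrite ex; apply: inp xp'.
- by apply: ep; rewrite ex'; apply: inp xp.
- exact: IHp.
Qed.

Lemma height_monotone_walk b x p y :
    walk x p y -> all (fun d => d.2 == b) p ->
  height y = if b then height x - (size p)%:Z else height x + (size p)%:Z.
Proof.
elim: p x => [|[e c] p IHp] x /=; first by move=> -> _; case: b; lia.
move=> [<- /IHp{}IHp] /andP[/eqP cb /IHp ->].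
by rewrite cb /dsource /dtarget /=; case: (b); rewrite height_par; lia.
Qed.

(** Once a walk without repeated edges has gone down, it cannot go up again:
    the only edge up would be the one just used.  So the last step, if not up,
    goes down the edge named by the end of the walk. *)
Lemma walk_up_or_ends_down x p y : walk x p y -> List.NoDup (map fst p) ->
  all (fun d => d.2 == true) p \/ List.In (y, false) p.
Proof.
elim: p x => [|[e b] p IHp] x /=; first by left.
move=> [ex py] /List.NoDup_cons_iff[ep np].
case: (IHp _ py np) => [up|]; last by right; right.
case: b ex py => /= ex py; first by left.
right; case: p py ep up {IHp np} => [<- | [c []] p [ce _] ep] //=; first by left.
by case: ep => /=; left.
Qed.

Lemma walk_down_or_starts_up x p y : walk x p y -> List.NoDup (map fst p) ->
  all (fun d => d.2 == false) p \/ List.In (x, true) p.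
Proof.
elim: p x => [|[e b] p IHp] x /=; first by left.
move=> [ex py] /List.NoDup_cons_iff[ep np].
case: b ex py => /= ex py; first by right; left; rewrite -ex.
case: (IHp _ py np) => [|]; first by left.
by move=> /(List.in_map fst).
Qed.

(** In a circuit at [x], which returns to its initial height, the first step
    must be up and the last down, and both use the edge named [x]. *)
Lemma parent_tree : inhabited V -> is_tree (E := V) id par.
Proof.
move=> inhV; split=> // [x y | x p [p0 xpx _ np]].
  have [k [l kl]] := par_meet x y.
  have [p xp] := walk_iter_par k x; have [q yq] := walk_iter_par l y.
  exists (p ++ walk_rev q); apply/walk_cat; exists (iter k par x) => //.
  by rewrite kl; apply: walk_rev_walk.
have sp : (0 < size p)%N by case: (p) p0.
case: (walk_up_or_ends_down xpx np) => [/(height_monotone_walk xpx)|xd]; first by lia.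
case: (walk_down_or_starts_up xpx np) => [/(height_monotone_walk xpx)|xu]; first by lia.
exact: NoDup_opposite xu xd.
Qed.

End ParentTree.

(** * The lamplighter group *)

(** Only boundedness below is imposed: it is what makes every two vertices of
    the tree have a common ancestor. *)
Record config := Config {
  lit :> int -> bool;
  lit_bounded : exists m : int, forall i, (i < m)%R -> lit i = false
}.

Lemma config_eq (f h : config) : f =1 h -> f = h.
Proof.
case: f h => [f bf] [h bh] /= /funext fh; move: bf bh; rewrite fh => bf bh.
by congr Config; apply: Prop_irrelevance.
Qed.

Section Configurations.
Local Open Scope ring_scope.
Implicit Types (f h : config) (M : int -> bool) (i k : int).

Fact dark_bounded : exists m : int, forall i, i < m -> (fun=> false) i = false.
Proof. by exists 0. Qed.
Definition dark : config := Config dark_bounded.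

Fact single_bounded k : exists m : int, forall i, i < m -> (i == k) = false.
Proof. by exists k => i; lia. Qed.
Definition single k : config := Config (single_bounded k).

Fact toggle_bounded f h : exists m : int, forall i, i < m -> f i (+) h i = false.
Proof.
case: (lit_bounded f) (lit_bounded h) => [m fm] [n hn].
by exists (Order.min m n) => i; rewrite lt_min => /andP[/fm -> /hn ->].
Qed.
Definition toggle f h : config := Config (toggle_bounded f h).

Fact translate_bounded k f : exists m : int, forall i, i < m -> f (i - k) = false.
Proof.
case: (lit_bounded f) => [m fm].
by exists (m + k) => i im; apply: fm; lia.
Qed.
Definition translate k f : config := Config (translate_bounded k f).

Fact mask_bounded M f : exists m : int, forall i, i < m -> f i && M i = false.
Proof. by case: (lit_bounded f) => [m fm]; exists m => i /fm ->. Qed.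
Definition mask M f : config := Config (mask_bounded M f).

End Configurations.

Record lamplighter := Lamplighter { switch : config; move_by : int }.

HB.instance Definition _ := gen_eqMixin lamplighter.
HB.instance Definition _ := gen_choiceMixin lamplighter.

Section LamplighterGroup.
Local Open Scope ring_scope.
Implicit Types g h : lamplighter.

Lemma lamplighter_eq g h :
  switch g =1 switch h -> move_by g = move_by h -> g = h.
Proof. by case: g h => [a k] [b l] /= /config_eq -> ->. Qed.

Definition ll_one : lamplighter := Lamplighter dark 0.
Definition ll_mul g h : lamplighter :=
  Lamplighter (toggle (switch g) (translate (move_by g) (switch h)))
              (move_by g + move_by h).
Definition ll_inv g : lamplighter :=
  Lamplighter (translate (- move_by g) (switch g)) (- move_by g).

Fact ll_mulA : associative ll_mul.
Proof.
move=> a b c; apply: lamplighter_eq => [i|] /=; last by rewrite addrA.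
by rewrite addbA opprD addrA.
Qed.

Fact ll_mul1g : left_id ll_one ll_mul.
Proof. by move=> a; apply: lamplighter_eq => [i|] /=; rewrite ?subr0 ?add0r. Qed.

Fact ll_mulg1 : right_id ll_one ll_mul.
Proof. by move=> a; apply: lamplighter_eq => [i|] /=; rewrite ?addbF ?addr0. Qed.

Fact ll_mulVg : left_inverse ll_one ll_inv ll_mul.
Proof. by move=> a; apply: lamplighter_eq => [i|] /=; rewrite ?addbb ?addNr. Qed.

Fact ll_mulgV : right_inverse ll_one ll_inv ll_mul.
Proof.
by move=> a; apply: lamplighter_eq => [i|] /=; rewrite ?opprK ?subrK ?addbb ?subrr.
Qed.

End LamplighterGroup.

HB.instance Definition _ :=
  isGroup.Build lamplighter ll_mulA ll_mul1g ll_mulg1 ll_mulVg ll_mulgV.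

(** * Coset spaces of subgroups of lamps *)

Section Cosets.
Local Open Scope ring_scope.
Implicit Types (M : int -> bool) (g : lamplighter) (i : int).

(** A model of G/H, where H is the group of the configurations that vanish on
    [M]: modulo H translated to [level], a configuration is determined by its
    values at the positions [i] such that [M (i - level)], and the others are
    normalized to be off. *)
Record coset M := Coset {
  level : int;
  visible : config;
  visible_mask : forall i, visible i -> M (i - level)
}.

Lemma coset_eq M (x y : coset M) :
  level x = level y -> visible x =1 visible y -> x = y.
Proof.
case: x y => [m f fM] [n h hM] /= mn /config_eq fh; move: fM hM.
by rewrite mn fh => fM hM; congr Coset; apply: Prop_irrelevance.
Qed.

Definition masked_coset M (n : int) (f : config) : coset M.
Proof.
by exists n (mask (fun i => M (i - n)) f) => i /andP[].
Defined.

Lemma visible_masked M (x : coset M) i :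
  visible x i && M (i - level x) = visible x i.
Proof. by case xi: (visible x i) => //=; apply: visible_mask xi. Qed.

Definition coset_act M g (x : coset M) : coset M :=
  masked_coset M (level x + move_by g)
    (toggle (switch g) (translate (move_by g) (visible x))).

Fact coset_act1 M (x : coset M) : coset_act 1%g x = x.
Proof.
apply: coset_eq => [|i] /=; first by rewrite addr0.
by rewrite addr0 subr0 visible_masked.
Qed.

Fact coset_actM M g h (x : coset M) :
  coset_act (g * h)%g x = coset_act g (coset_act h x).
Proof.
apply: coset_eq => [|i] /=; first by rewrite (addrC (move_by g)) addrA.
have -> : i - (level x + (move_by g + move_by h)) =
          i - (level x + move_by h + move_by g) by lia.
have -> : i - move_by g - (level x + move_by h) =
          i - (level x + move_by h + move_by g) by lia.
have -> : i - (move_by g + move_by h) = i - move_by g - move_by h by lia.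
by case: (M _); rewrite ?andbF // !andbT addbA.
Qed.

Definition coset_gset M : gset lamplighter :=
  GSet (@coset_act1 M) (@coset_actM M).

Definition lamp i : lamplighter := Lamplighter (single i) 0.

Lemma lamp_stab M i (x : coset_gset M) :
  stab x (lamp i) <-> ~~ M (i - level x).
Proof.
split=> [xi | Mi].
  apply/negP => Mi; have /(congr1 (@visible M)) := xi.
  move=> /(congr1 (fun f : config => f i)) /=.
  by rewrite addr0 subr0 eqxx Mi; case: (visible x i).
apply: coset_eq => [|j] /=; first by rewrite addr0.
rewrite addr0 subr0; have [->|_] /= := eqVneq j i; last exact: visible_masked.
by rewrite -[RHS]visible_masked (negPf Mi) !andbF.
Qed.

(** The element is the sum of the two visible configurations, suitably
    translated; without translation it is an involution. *)
Lemma coset_transitive_swap M (x y : coset_gset M) :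
  exists2 g, gact g x = y & level x = level y -> gact g y = x.
Proof.
pose k := level y - level x.
exists (Lamplighter (toggle (visible y) (translate k (visible x))) k).
  apply: coset_eq => [|i] /=; first by rewrite addrC subrK.
  by rewrite [_ + k]addrC subrK -addbA addbb addbF visible_masked.
move=> xy; have k0 : k = 0 by rewrite /k xy subrr.
apply: coset_eq => [|i] /=; rewrite k0 addr0 ?subr0 -?xy //.
by rewrite (addbC (visible y i)) -addbA addbb addbF visible_masked.
Qed.

Definition restrict M M' (s : int) (x : coset_gset M) : coset_gset M' :=
  masked_coset M' (level x + s) (visible x).

(** The condition says that the positions still visible after moving to the
    new level were visible before. *)
Lemma restrict_gmap M M' s :
  (forall i, M' (i - s) -> M i) -> gmap (@restrict M M' s).
Proof.
move=> subM g x; apply: coset_eq => [|i] /=; first by rewrite addrAC.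
have -> : i - move_by g - (level x + s) = i - (level x + s + move_by g) by lia.
rewrite [level x + _ + s]addrAC.
case Mi: (M' _); rewrite ?andbF // !andbT.
suff -> : M (i - (level x + move_by g)) by rewrite andbT.
apply: subM.
by have -> : i - (level x + move_by g) - s = i - (level x + s + move_by g) by lia.
Qed.

End Cosets.

(** * A retract that is not a vertex set *)

Section SumGset.
Variables (G : groupType) (A B : gset G).

Definition sum_act (g : G) (x : A + B) : A + B :=
  match x with inl a => inl (gact g a) | inr b => inr (gact g b) end.

Fact sum_act1 x : sum_act 1%g x = x.
Proof. by case: x => a /=; rewrite gact1. Qed.

Fact sum_actM g h x : sum_act (g * h)%g x = sum_act g (sum_act h x).
Proof. by case: x => a /=; rewrite gactM. Qed.

Definition sum_gset : gset G := GSet sum_act1 sum_actM.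

End SumGset.

Section LamplighterTree.
Local Open Scope ring_scope.

Definition below (i : int) : bool := i < 0.
Definition below_and_one (i : int) : bool := (i < 0) || (i == 1).

Notation W := (coset_gset below).
Notation U := (coset_gset below_and_one).
Notation V := (sum_gset W U).

Definition parent (v : V) : V :=
  match v with
  | inl w => inl (restrict below (-1) w)
  | inr u => inl (restrict below 0 u)
  end.

Fact parent_gmap : gmap parent.
Proof.
by move=> g [x|x]; rewrite /= restrict_gmap // /below /below_and_one => i; lia.
Qed.

Definition height (v : V) : int :=
  match v with inl w => level w | inr u => level u + 1 end.

Lemma height_parent v : height (parent v) = height v - 1.
Proof. by case: v => x /=; lia. Qed.

Lemma iter_parent k (w : W) :
  iter k parent (inl w) = inl (restrict below (- k%:Z) w).
Proof.
elim: k => [|k IHk] /=; last rewrite IHk /=; congr inl; apply: coset_eq => [|i] /=.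
- by lia.
- by rewrite oppr0 addr0 visible_masked.
- by lia.
- by rewrite -andbA; congr (_ && _); rewrite /below; lia.
Qed.

Lemma parent_reaches_dark v : exists n : int, forall m, m <= n ->
  exists k, iter k parent v = inl (masked_coset below m dark).
Proof.
have reachW (w : W) : exists n : int, forall m, m <= n ->
    exists k, iter k parent (inl w) = inl (masked_coset below m dark).
  have [n wn] := lit_bounded (visible w).
  exists (Order.min n (level w)) => m; rewrite le_min => /andP[mn mw].
  exists `|level w - m|%N; rewrite iter_parent; congr inl.
  apply: coset_eq => [|i] /=; first by lia.
  apply/negP => /andP[wi]; rewrite /below => im.
  by move: wi; rewrite wn //; lia.
case: v => [w|u]; first exact: reachW.
have [n un] := reachW (restrict below 0 u).
by exists n => m /un[k uk]; exists k.+1; rewrite iterSr.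
Qed.

Lemma parent_meet x y : exists k l, iter k parent x = iter l parent y.
Proof.
have [n xn] := parent_reaches_dark x; have [m ym] := parent_reaches_dark y.
have [|k xk] := xn (Order.min n m); first by rewrite ge_min lexx.
have [|l yl] := ym (Order.min n m); first by rewrite ge_min lexx orbT.
by exists k, l; rewrite xk yl.
Qed.

Fact V_inhabited : inhabited V.
Proof. exact: inhabits (inl (masked_coset below 0 dark)). Qed.

Definition lamplighter_tree : ggraph lamplighter :=
  @GGraph _ V V id parent V_inhabited (fun _ _ => erefl) parent_gmap.

Lemma lamplighter_tree_gtree : gtree lamplighter_tree.
Proof. exact: (parent_tree height_parent parent_meet V_inhabited). Qed.

Lemma U_retract : retract_of_vertices U.
Proof.
exists lamplighter_tree; split; first exact: lamplighter_tree_gtree.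
exists inr; split=> // [x y [] // |].
split=> [g v [u <-] | [w _|u []]]; [by exists (gact g u) | | by exists u].
(* The position m + 1 seen from level m must lie below the level n of [w], so
   m = n - 2 is the highest level that works. *)
exists (inr (restrict below_and_one (-2%:Z) w)); split; first by eexists.
move=> g [gw]; congr inr; rewrite -restrict_gmap ?(gw : gact g w = w) // => i.
by rewrite /below /below_and_one; lia.
Qed.

Lemma U_not_vertex_set : ~ is_vertex_set U.
Proof.
move=> [T [treeT [f [fG [f' fK f'K]]]]].
have f'G g v : f' (gact g v) = gact g (f' v) by rewrite -{1}[v]f'K -fG fK.
have level_f n : level (f' (f (masked_coset below_and_one n dark : U))) = n.
  by rewrite fK.
apply: (@no_tree_with_levels _ T (fun v => level (f' v)) move_by lamp treeT _ _ _
  _ _ _ (level_f 0) (level_f 1) (level_f (- 2%:Z))) => [g x | i x | x y].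
- by rewrite f'G.
- have -> : (i < level (f' x)) || (i == level (f' x) + 1) =
            below_and_one (i - level (f' x)) by rewrite /below_and_one; lia.
  rewrite -lamp_stab /stab -f'G; split=> [-> // | ].
  exact: (can_inj f'K).
- have [g gx gy] := coset_transitive_swap (f' x) (f' y).
  exists g; first by apply: (can_inj f'K); rewrite f'G.
  by move=> /gy gyx; apply: (can_inj f'K); rewrite f'G.
Qed.

End LamplighterTree.

Theorem theorem7p7 :
  exists (G : groupType) (U : gset G),
    retract_of_vertices U /\ ~ is_vertex_set U.
Proof.
exists lamplighter, (coset_gset below_and_one).
by split; [exact: U_retract | exact: U_not_vertex_set].
Qed.
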